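(* Let $k\ge 1$ and $n \ge 1$ be integers. The number of signed permutations in $S^{\mathrm{B}}_n$ that globally avoid both the pattern $132$ and the increasing pattern $12\cdots k(k+1)\in S_{k+1}$ is $f^{(k)}_{n+k+1}$.
   Context: Notation: $[n]=\{1,\dots,n\}$ and $[\pm n]=\{\pm1,\dots,\pm n\}$. Elements of the symmetric group $S_m$ are written in one-line notation $p(1)\cdots p(m)$. $S^{\mathrm{B}}_n$ is the set (group) of signed permutations of size $n$, i.e. bijections $w:[\pm n]\to[\pm n]$ with $w(-x)=-w(x)$ for all $x\in[n]$. Global avoidance: for $p\in S_m$, a signed permutation $w\in S^{\mathrm{B}}_n$ globally contains $p$ if there are indices $i_1<\cdots<i_m$ in $[\pm n]$ (in the usual order of the integers) such that $w(i_1)\cdots w(i_m)$ is order-isomorphic to $p$; otherwise $w$ globally avoids $p$. For positive integers $i$ and $k$, define \[ f^{(k)}_i := \begin{cases} \displaystyle\sum_{j=1}^k f^{(k)}_{i-j} & \text{if } i>k,\\ 1 & \text{if } i=\lfloor k/2\rfloor+1,\\ 0 & \text{otherwise.} \end{cases} \] *)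

(* Defs.v *)
From mathcomp Require Import all_boot all_order all_algebra all_fingroup.
From HB Require Import structures.

Set Implicit Arguments.
Unset Strict Implicit.
Unset Printing Implicit Defensive.

Import Order.TTheory GRing.Theory Num.Theory.

Local Open Scope ring_scope.

(* The set [±n] = {±1, ..., ±n}, as a subtype of int; the order used on it
   throughout is the usual order of int, through val. *)
Definition in_pm (n : nat) (x : int) : bool := (0 < `|x| <= n%:Z).

Record pm (n : nat) : Type := Pm { pm_val : int; pm_valP : in_pm n pm_val }.

HB.instance Definition _ (n : nat) := [isSub for @pm_val n].
HB.instance Definition _ (n : nat) := [Countable of pm n by <:].

Definition pm_seq (n : nat) : seq int :=
  [seq - (i.+1)%:Z | i <- iota 0 n] ++ [seq (i.+1)%:Z | i <- iota 0 n].

Lemma mem_pm_seq (n : nat) (x : int) : in_pm n x -> x \in pm_seq n.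
Proof.
rewrite /in_pm mem_cat => /andP[x0 xn]; apply/orP.
case: x x0 xn => [[//|i]|i] _ xn; [right | left]; apply/mapP; exists i;
  by rewrite ?mem_iota ?NegzE.
Qed.

Lemma pm_seq_uniq (n : nat) : uniq (pm_seq n).
Proof.
rewrite cat_uniq !map_inj_uniq ?iota_uniq ?andbT //=.
- by apply/hasPn => x /mapP[i _ ->]; apply/mapP => -[].
- by move=> i j [].
- by move=> i j /oppr_inj[].
Qed.

Lemma pm_enum_subproof (n : nat) :
  Finite.axiom (pmap insub (pm_seq n) : seq (pm n)).
Proof.
move=> x; rewrite count_uniq_mem; first by rewrite mem_pmap_sub mem_pm_seq ?(pm_valP x).
by rewrite pmap_sub_uniq ?pm_seq_uniq.
Qed.

HB.instance Definition _ (n : nat) := isFinite.Build (pm n) (@pm_enum_subproof n).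

Lemma in_pm_opp (n : nat) (x : pm n) : in_pm n (- val x).
Proof. by rewrite /in_pm normrN; exact: (pm_valP x). Qed.

Definition pm_opp (n : nat) (x : pm n) : pm n := Pm (in_pm_opp x).

Definition SB (n : nat) : {set {perm pm n}} :=
  [set w : {perm pm n} | [forall x : pm n, (0 < val x) ==> (w (pm_opp x) == pm_opp (w x))]].

Definition globally_contains (n m : nat) (w : {perm pm n}) (p : 'S_m) : bool :=
  [exists i : {ffun 'I_m -> pm n},
    [forall a : 'I_m, forall b : 'I_m, (a < b)%N ==> (val (i a) < val (i b))] &&
    [forall a : 'I_m, forall b : 'I_m, (val (w (i a)) < val (w (i b))) == (p a < p b)%N]].

Definition globally_avoids (n m : nat) (w : {perm pm n}) (p : 'S_m) : bool :=
  ~~ globally_contains w p.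

(* 'S_m permutes {0, ..., m-1}, so one-line notations are shifted by one. *)
Definition pat132 : 'S_3 := tperm (inord 1) (inord 2).

Lemma pat132_one_line : [seq (val (pat132 i)).+1 | i <- enum 'I_3] = [:: 1; 3; 2]%N.
Proof.
rewrite /pat132 (map_comp S (fun i : 'I_3 => val (tperm (inord 1) (inord 2) i))).
rewrite !enum_ordSl enum_ord0 /= !permE /= -!(inj_eq val_inj) /= !inordK //.
Qed.

Definition pat_incr (m : nat) : 'S_m := 1%g.

(* ftab k i lists f^(k)_i, f^(k)_(i-1), ..., f^(k)_0, where the value at index 0
   is a dummy that the recurrence never reads (see fkE). *)
Fixpoint ftab (k i : nat) : seq nat :=
  if i is i'.+1 then
    (if (k < i)%N then sumn (take k (ftab k i')) else (i == k./2.+1)%N : nat)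
      :: ftab k i'
  else [:: 0%N].

Definition fk (k i : nat) : nat := head 0%N (ftab k i).

Lemma size_ftab (k i : nat) : size (ftab k i) = i.+1.
Proof. by elim: i => //= i ->. Qed.

Lemma nth_ftab (k i j : nat) : (j <= i)%N -> nth 0%N (ftab k i) j = fk k (i - j).
Proof.
elim: i j => [|i IHi] [|j] //= ji.
by rewrite IHi // subSS.
Qed.

Lemma fkE (k i : nat) : (0 < i)%N ->
  fk k i = if (k < i)%N then (\sum_(1 <= j < k.+1) fk k (i - j))%N
          else if i == k./2.+1 then 1%N else 0%N.
Proof.
case: i => // i _; rewrite {1}/fk /=; case: ifP => ki; last by case: eqP.
rewrite sumnE (big_nth 0%N) size_takel ?size_ftab 1?ltnW //.
rewrite big_add1 /=; apply: eq_big_nat => j /andP[_ jk].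
by rewrite nth_take // nth_ftab ?subSS // (leq_trans (ltnW jk)).
Qed.

(* Main.v *)
(* A signed permutation, written as the word w(-n) ... w(-1) w(1) ... w(n), is
   invariant under reverse-complement, so avoiding 132 forces it to avoid 213
   too.  Such a word is a skew sum of increasing runs of consecutive values,
   hence encodes a palindromic composition of 2n; avoiding 12...(k+1) means that
   no part exceeds k.  Removing the first and the last part (both equal to a)
   gives g(n) = [2n <= k] + sum_(1 <= a <= min(k, n)) g(n - a), where the first
   term counts the one-part composition, and n |-> f^(k)_(n+k+1) satisfies the
   same recurrence: the 1 at index k/2 + 1 enters the sum exactly when
   2n <= k. *)
Require Import Defs.
From mathcomp Require Import all_boot all_order all_algebra all_fingroup zify.

Set Implicit Arguments.
Unset Strict Implicit.
Unset Printing Implicit Defensive.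

Import Order.TTheory GRing.Theory Num.Theory.

Local Open Scope ring_scope.

(** * Words avoiding 132 or long increasing subsequences *)

Definition seq_avoids132 (s : seq int) : Prop :=
  forall x y z : int, subseq [:: x; y; z] s -> ~ (x < z < y).

(** For words, this is avoidance of 12...(k+1). *)
Definition incr_le (k : nat) (s : seq int) : Prop :=
  forall t : seq int, subseq t s -> sorted <%R t -> (size t <= k)%N.

Lemma seq_avoids132_subseq (s t : seq int) :
  subseq s t -> seq_avoids132 t -> seq_avoids132 s.
Proof. by move=> st At x y z /subseq_trans/(_ st); apply: At. Qed.

Lemma incr_le_subseq (k : nat) (s t : seq int) :
  subseq s t -> incr_le k t -> incr_le k s.
Proof. by move=> st It r /subseq_trans/(_ st); apply: It. Qed.

Lemma seq_avoids132_sorted (s : seq int) : sorted <%R s -> seq_avoids132 s.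
Proof.
by move=> ss x y z /subseq_lt_sorted/(_ ss) /= /and3P[xy yz _]; lia.
Qed.

Lemma incr_le_sorted (k : nat) (s : seq int) :
  sorted <%R s -> incr_le k s <-> (size s <= k)%N.
Proof.
move=> ss; split=> [|sk t ts _]; first by apply.
exact: leq_trans (size_subseq ts) sk.
Qed.

Lemma subseq_catE (T : eqType) (t s1 s2 : seq T) : subseq t (s1 ++ s2) ->
  exists t1 t2, [/\ t = t1 ++ t2, subseq t1 s1 & subseq t2 s2].
Proof.
case/subseqP=> m; rewrite size_cat => sm ->.
exists (mask (take (size s1) m) s1), (mask (drop (size s1) m) s2).
rewrite !mask_subseq -mask_cat ?cat_take_drop //.
by rewrite size_takel // sm leq_addr.
Qed.

(** The smallest letter of a 132 comes first. If it lies in [s], the last letter, being larger,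
    cannot lie in [t]; so an occurrence stays within [s] or within [t]. *)
Lemma seq_avoids132_skew (s t : seq int) : allrel >%R s t ->
  seq_avoids132 s -> seq_avoids132 t -> seq_avoids132 (s ++ t).
Proof.
move=> /allrelP st As At x y z /subseq_catE[t1 [t2 [E]]].
move=> /[dup]/mem_subseq m1 s1 /[dup]/mem_subseq m2 s2.
case: t1 E m1 s1 => [|a [|b [|c [|? ?]]]] //=.
- by move=> E _ _; apply: At; rewrite E.
- case=> <- E m1 _ /andP[xz _].
  have := st x z (m1 _ _) (m2 _ _); rewrite -E !inE !eqxx ?orbT //= => /(_ isT isT); lia.
- case=> <- <- E m1 _ /andP[xz _].
  have := st x z (m1 _ _) (m2 _ _); rewrite -E !inE !eqxx ?orbT //= => /(_ isT isT); lia.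
- by case=> <- <- <- _ m1 s1; apply: As.
Qed.

(** No ascent passes from [s] to [t], so an increasing subsequence lies within one of them. *)
Lemma incr_le_skew (k : nat) (s t : seq int) : allrel >%R s t ->
  incr_le k s -> incr_le k t -> incr_le k (s ++ t).
Proof.
move=> /allrelP st Is It r /subseq_catE[t1 [t2 [-> s1 s2]]] sr.
have [/Is l1 /It l2] := cat_sorted2 sr.
case: t1 t2 => [|x t1] [|y t2] // in s1 s2 sr l1 l2 *; rewrite ?cats0; try exact: l1; try exact: l2.
have := st x y (mem_subseq s1 (mem_head _ _)) (mem_subseq s2 (mem_head _ _)).
move: sr; rewrite lt_sorted_pairwise pairwise_cat /= => /andP[/andP[/andP[xy _] _] _].
lia.
Qed.

(** * Symmetric words and their windows *)

(* The word w(-n) ... w(-1) w(1) ... w(n) of the signed permutation whose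
   window is u = w(1) ... w(n). *)
Definition full (u : seq int) : seq int := rev (map -%R u) ++ u.

Lemma full_cat (u v : seq int) : full (u ++ v) = rev (map -%R v) ++ full u ++ v.
Proof. by rewrite /full map_cat rev_cat !catA. Qed.

Lemma mem_full (u : seq int) (x : int) : (x \in full u) = (x \in u) || (- x \in u).
Proof.
rewrite mem_cat orbC mem_rev; congr (_ || _); apply/mapP/idP => [[y yu ->]|].
  by rewrite opprK.
by exists (- x); rewrite ?opprK.
Qed.

(** Plain words stand in for permutations of [pm n], so that the recursion can change n freely. *)
Definition window (k n : nat) (u : seq int) : Prop :=
  [/\ perm_eq (map absz u) (iota 1 n), seq_avoids132 (full u) & incr_le k (full u)].

Lemma size_window k n u : window k n u -> size u = n.
Proof. by case=> /perm_size; rewrite size_map size_iota. Qed.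

Lemma mem_window k n u x : window k n u -> x \in u -> (0 < `|x|%N <= n)%N.
Proof.
case=> /perm_mem E _ _ xu; have := E `|x|%N.
by rewrite map_f // mem_iota add1n ltnS.
Qed.

Lemma window_inj k n u : window k n u -> {in u &, injective absz}.
Proof.
case=> /perm_uniq; rewrite iota_uniq => U _ _ x y /(nthP 0) [i iu <-] /(nthP 0) [j ju <-].
move=> E; congr nth; apply/eqP; rewrite -(nth_uniq 0%N _ _ U) ?size_map //.
by rewrite !(nth_map 0) // E.
Qed.

(** * The identity window and the last blocks *)

Definition top_window (n : nat) : seq int := map Posz (iota 1 n).

(** For a <= n, the increasing run -n, ..., -(n-a+1): the last part a of the composition. *)
Definition block (n a : nat) : seq int := map (fun i => - i%:Z) (rev (iota (n - a).+1 a)).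

Lemma size_block n a : size (block n a) = a.
Proof. by rewrite size_map size_rev size_iota. Qed.

Lemma sorted_top n : sorted <%R (full (top_window n)).
Proof.
elim: n => // n; rewrite /top_window -[n.+1]addn1 iotaD map_cat full_cat add1n /=.
have: all (fun x => `|x|%N <= n)%N (full (top_window n)).
  apply/allP=> x; rewrite mem_full => /orP[] /mapP[i]; rewrite mem_iota; lia.
rewrite /top_window; move: (full _) => s /allP H; rewrite !lt_sorted_pairwise => IH.
rewrite lt_path_pairwise /= pairwise_cat all_cat allrel1r IH /= !andbT.
by apply/andP; split; apply/allP=> x /H; lia.
Qed.

Lemma mem_block n a x : (a <= n)%N -> x \in block n a -> (- n%:Z <= x <= - (n - a).+1%:Z).
Proof. by move=> an /mapP[i]; rewrite mem_rev mem_iota => ? ->; lia. Qed.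

Lemma sorted_block n a : sorted <%R (block n a).
Proof.
rewrite /block map_rev rev_sorted.
by apply: homo_sorted (iota_ltn_sorted _ _) => x y /=; lia.
Qed.

Lemma sorted_rev_opp (s : seq int) :
  sorted <%R (rev (map -%R s)) = sorted <%R s.
Proof.
rewrite rev_sorted sorted_map; apply: eq_sorted => x y /=; exact: ltrN2.
Qed.

(** * Building windows and splitting off the last block *)

(** Sorting [P] and [Q] separately already sorts [P ++ Q], which gives the interval; it is then cut
    after [size P] terms. *)
Lemma perm_iota_cat m n (P Q : seq nat) : allrel ltn P Q ->
  perm_eq (P ++ Q) (iota m n) ->
  perm_eq P (iota m (size P)) /\ perm_eq Q (iota (m + size P) (size Q)).
Proof.
move=> /allrelP PQ E.
have /eqP: sort leq P ++ sort leq Q = iota m (size P + size Q).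
  rewrite -size_cat (perm_size E) size_iota.
  apply: (sorted_eq leq_trans anti_leq _ (iota_sorted m n)); last first.
    by rewrite (perm_trans _ E) // perm_cat ?perm_sort.
  rewrite (sorted_pairwise leq_trans) pairwise_cat -!(sorted_pairwise leq_trans).
  rewrite !(sort_sorted leq_total) !andbT; apply/allrelP=> x y.
  by rewrite !mem_sort => xP yQ; exact: ltnW (PQ _ _ xP yQ).
rewrite iotaD eqseq_cat ?size_sort ?size_iota // => /andP[/eqP <- /eqP <-].
by split; rewrite perm_sym perm_sort.
Qed.

Lemma mem_full_abs (u : seq int) x : (x \in full u) = (`|x|%N \in map absz u).
Proof.
rewrite mem_full; apply/orP/mapP=> [[xu|xu]|[y yu E]].
- by exists x.
- by exists (- x); rewrite ?abszN.
- have [->|->] : x = y \/ x = - y by lia.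
    by left.
  by right; rewrite opprK.
Qed.

Lemma mem_full_window k n u x : window k n u -> (x \in full u) = (0 < `|x|%N <= n)%N.
Proof. by case=> /perm_mem E _ _; rewrite mem_full_abs E mem_iota add1n ltnS. Qed.

Lemma uniq_full k n u : window k n u -> uniq (full u).
Proof.
move=> W; have [/perm_uniq Uu _ _] := W.
rewrite iota_uniq in Uu; have U := map_uniq Uu.
rewrite cat_uniq rev_uniq (map_inj_uniq (@oppr_inj _)) U /= andbT.
apply/hasPn=> x xu; apply/negP; rewrite mem_rev => /mapP[y yu E].
have := window_inj W xu yu; have := mem_window W xu; rewrite {}E; lia.
Qed.

(** Two later letters in decreasing order would form a 132 with [m] as its 1. *)
Lemma avoids132_min_sorted (m : int) (t : seq int) :
  seq_avoids132 (m :: t) -> uniq t -> all (> m) t -> sorted <%R (m :: t).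
Proof.
move=> A U H; rewrite lt_sorted_pairwise /= H /=.
elim: t A U H => //= x t IH A /andP[xt U] /andP[mx H].
apply/andP; split; last first.
  apply: IH => //; apply: seq_avoids132_subseq A.
  by rewrite -cat1s -[_ :: x :: t]cat1s subseq_cat2l subseq_cons.
apply/allP=> y yt; have := A m x y; rewrite /= !eqxx sub1seq yt => /(_ isT).
have : y != x by apply: contraNneq xt => <-.
by have := allP H y yt; lia.
Qed.

(** A strictly increasing word is determined by its letters, here all of [±n]; as its own increasing
    subsequence it has length 2n <= k. *)
Lemma window_incr k n u :
  window k n u -> sorted <%R (full u) -> u = top_window n /\ (n.*2 <= k)%N.
Proof.
move=> W S; have sz := size_window W; split.
  have /eqP : full u = full (top_window n).
    apply: lt_sorted_eq => //; first exact: sorted_top.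
    move=> x; rewrite (mem_full_window _ W) mem_full_abs -map_comp map_id_in //.
    by rewrite mem_iota add1n ltnS.
  by rewrite eqseq_cat ?size_rev ?size_map ?size_iota // => /andP[_ /eqP].
case: W => _ _ /(incr_le_sorted _ S).
by rewrite size_cat size_rev size_map sz addnn.
Qed.

Lemma window_top k n : (n.*2 <= k)%N -> window k n (top_window n).
Proof.
move=> nk; split.
- by rewrite -map_comp map_id_in.
- exact/seq_avoids132_sorted/sorted_top.
- apply/incr_le_sorted; first exact: sorted_top.
  by rewrite size_cat size_rev !size_map size_iota addnn.
Qed.

(** By [full_cat] the new word is a skew sum of the negated reversed block, [full u] and the block;
    the outer two are increasing of length a <= k. *)
Lemma window_cat_block k n a u : (0 < a <= minn k n)%N -> window k (n - a) u ->
  window k n (u ++ block n a).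
Proof.
move=> /andP[a0]; rewrite leq_min => /andP[ak an] W; have [P A I] := W.
have F x : x \in full u -> (`|x| <= n - a)%N.
  by rewrite (mem_full_window _ W) => /andP[].
have Sb := sorted_block n a; have Sb' : sorted <%R (rev (map -%R (block n a))).
  by rewrite sorted_rev_opp.
have R1 : allrel >%R (full u) (block n a).
  by apply/allrelP=> x y /F xa /(mem_block an); lia.
have R2 : allrel >%R (rev (map -%R (block n a))) (full u ++ block n a).
  apply/allrelP=> x y; rewrite mem_rev mem_cat => /mapP[z /(mem_block an) zb ->].
  by case/orP=> [/F|/(mem_block an)]; lia.
split.
- rewrite map_cat -(subnK an) iotaD perm_cat //; rewrite subnK //.
  rewrite -map_comp (eq_map (g := id)) ?map_id; last by move=> i /=; lia.
  by rewrite add1n perm_rev.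
- rewrite full_cat; apply: seq_avoids132_skew => //.
    exact: seq_avoids132_sorted.
  by apply: seq_avoids132_skew => //; exact: seq_avoids132_sorted.
- rewrite full_cat; apply: incr_le_skew => //.
    by apply/incr_le_sorted; rewrite // size_rev size_map size_block.
  by apply: incr_le_skew => //; apply/incr_le_sorted; rewrite ?size_block.
Qed.

(* The position of n or -n in u decides: if n occurs, the pattern 132 starting at
   w(-n) = -n makes the whole word increasing; if -n occurs, the entries from it
   onwards are the last block, because n precedes everything but the opposite of
   that block and can thus play the role of 3. *)
Lemma window_split k n u : window k n u ->
  (u = top_window n /\ (n.*2 <= k)%N) \/
  exists a v, [/\ (0 < a <= minn k n)%N, window k (n - a) v & u = v ++ block n a].
Proof.
move=> W; have U := uniq_full W; have [P A I] := W.
have [n0|n0] := posnP n.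
  left; apply: window_incr (W) _; have /size0nil -> // : size u = 0%N.
  by rewrite (size_window W).
have B x := mem_full_window x W.
have : n \in map absz u by rewrite (perm_mem P) mem_iota n0 add1n ltnS /=.
case/mapP=> x xu xn; have [E|E] : x = n \/ x = - n%:Z by lia.
  left; apply: window_incr (W) _; case/splitPr: u / xu => p q in W U P A B I *.
  (* A letter c after n would give the 132 formed by -n, n, c; it differs from n and -n because the
     word has no repetition. *)
  rewrite {x xn}E in W U P A B I *; have q0 : q = [::].
    case: q => // c q in W U P A B I *.
    have := A (- n%:Z) n c; rewrite full_cat => /(_ _)H; exfalso; apply: H.
      rewrite -[[:: _; _; _]]/([:: - n%:Z] ++ [::] ++ [:: n%:Z; c]).
      rewrite !cat_subseq ?sub0seq ?sub1seq /= ?eqxx ?sub0seq //.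
      by rewrite mem_rev mem_head.
    have := B c; rewrite mem_full mem_cat !inE eqxx !orbT => /esym cn.
    have : uniq (full (p ++ n%:Z :: c :: q)) := U.
    rewrite full_cat !cat_uniq => /and3P[_ /hasPn dj /and3P[_ _ /= /andP[nc _]]].
    have := dj c; rewrite mem_cat !inE eqxx !orbT mem_rev inE => /(_ isT).
    move: nc; rewrite inE => /norP[/eqP nc _] /norP[/eqP nc' _]; lia.
  (* Since n ends the window, -n opens the whole word and is its minimum. *)
  move: U A B; rewrite q0 full_cat /= => U A B.
  apply: avoids132_min_sorted => //; first by case/andP: U.
  apply/allP=> y yt; have : y != - n%:Z.
    by apply: contraTneq U => <-; rewrite /= yt.
  have := B y; rewrite inE yt orbT; lia.
right; case/splitPr: u / xu => p q in W U P A B I *.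
rewrite {x xn}E in W U P A B I *.
set b := (- n%:Z :: q) in W U P A B I *.
have Eb : rev (map -%R b) = rev (map -%R q) ++ [:: n%:Z].
  by rewrite /= rev_cons cats1 opprK.
rewrite full_cat in U A B I.
(* -n opens [b] and is its minimum, so [b] is increasing. *)
have Sb : sorted <%R b.
  have bF : subseq b (rev (map -%R b) ++ full p ++ b).
    by apply: subseq_trans (suffix_subseq _ _); apply: suffix_subseq.
  have /andP[nq Uq] := subseq_uniq bF U.
  apply: avoids132_min_sorted => //; first exact: seq_avoids132_subseq A.
  apply/allP=> y yq; have : y != - n%:Z by apply: contraNneq nq => <-.
  by have := B y; rewrite (mem_subseq bF) ?inE ?yq ?orbT //; lia.
(* The negated reversal of [b] ends with n, so -y, n, z occur in this order, with n as a possible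
   3. *)
have Q y z : y \in q -> z \in full p ++ q -> ~ (- y < z < n%:Z).
  move=> yq zpq; apply: A; rewrite Eb -catA.
  rewrite -[[:: _; _; _]]/([:: - y] ++ [:: n%:Z] ++ [:: z]).
  rewrite !cat_subseq ?sub1seq ?inE ?eqxx //.
    by rewrite mem_rev map_f.
  by move: zpq; rewrite !mem_cat inE => /orP[]->; rewrite ?orbT.
have bF : subseq b (rev (map -%R b) ++ full p ++ b).
  by apply: subseq_trans (suffix_subseq _ _); apply: suffix_subseq.
have pF : subseq (full p) (rev (map -%R b) ++ full p ++ b).
  by apply: subseq_trans (suffix_subseq _ _); apply: prefix_subseq.
have [/hasPn nF Upb] : ~~ has (mem (rev (map -%R b))) (full p ++ b) /\ uniq (full p ++ b).
  by move: U; rewrite cat_uniq => /and3P[].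
move: (Upb); rewrite cat_uniq => /and3P[_ /hasPn dpb _].
have ltn_n (z : int) : z \in full p ++ b -> z < n%:Z.
  move=> zF; have := nF z zF; rewrite /= mem_rev inE opprK => /norP[/eqP zn _].
  by have := B z; rewrite mem_cat zF orbT; lia.
have absb (y : int) : y \in b -> (0 < `|y|%N <= n)%N.
  by move=> yb; rewrite -B (mem_subseq bF).
have neg (y : int) : y \in b -> y < 0.
  rewrite inE => /orP[/eqP -> | yq]; first by lia.
  have yb : y \in b by rewrite inE yq orbT.
  (* With z = y: since y < n, the inequality -y < y must fail, and y is nonzero. *)
  have := @Q y y yq; rewrite mem_cat yq orbT => /(_ isT).
  have := absb y yb; have := ltn_n y; rewrite mem_cat yb orbT => /(_ isT); lia.
have full_opp (z : int) : z \in full p -> - z \in full p.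
  by rewrite !mem_full opprK orbC.
have bp (y z : int) : y \in b -> z \in full p -> y < z.
  move=> yb zp; have zp' := full_opp _ zp.
  have := ltn_n (- z); rewrite mem_cat zp' => /(_ isT) zn.
  move: yb (dpb y yb) => /=; rewrite inE => /orP[/eqP -> | yq] yz; first by lia.
  (* Since -z < n, [Q] at -z gives y <= z, and the two letters are distinct. *)
  have := @Q y (- z) yq; rewrite mem_cat zp' => /(_ isT).
  have : y != z by apply: contraNneq yz => ->.
  lia.
have szn : (size p + size b = n)%N by rewrite -size_cat (size_window W).
have szb : size (map absz b) = size b by rewrite size_map.
(* Letters of [b] lie below both x and -x for every x in [p], so their absolute values are exactly
   the [size b] largest ones. *)
have [] := @perm_iota_cat 1 n (map absz p) (map absz b).
- apply/allrelP=> _ _ /mapP[x xp ->] /mapP[y yb ->] /=.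
  have xp' : x \in full p by rewrite mem_full xp.
  have := bp y x yb xp'; have := bp y (- x) yb (full_opp _ xp'); lia.
- by rewrite -map_cat.
rewrite szb size_map add1n => Pp Pb.
exists (size b), p; rewrite -[n in (n - _)%N]szn addnK; split.
- by rewrite leq_min (I _ bF Sb) -szn leq_addl.
- split=> //; [exact: seq_avoids132_subseq A | exact: incr_le_subseq I].
- congr (_ ++ _); apply: lt_sorted_eq; rewrite ?sorted_block //.
  have Ub : uniq b by move: Upb; rewrite cat_uniq => /and3P[].
  have sub : {subset b <= block n (size b)}.
    move=> y yb; apply/mapP; exists `|y|%N; last by have := neg y yb; lia.
    by rewrite mem_rev -{1}szn addnK -(perm_mem Pb) map_f.
  by have [] := uniq_min_size Ub sub; rewrite ?size_block.
Qed.

(** * Enumeration of the windows and its recurrence *)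

(* The argument f is fuel: the list is the intended one as soon as n < f. *)
Fixpoint windows (k f n : nat) : seq (seq int) :=
  if f is f'.+1 then
    (if (n.*2 <= k)%N then [:: top_window n] else [::]) ++
    [seq v ++ block n a | a <- iota 1 (minn k n), v <- windows k f' (n - a)]
  else [::].

Lemma mem_windows k f n u : (n < f)%N -> u \in windows k f n <-> window k n u.
Proof.
elim: f n u => // f IH n u nf; rewrite /= mem_cat; split.
  case/orP; first by case: ifP => // nk; rewrite inE => /eqP ->; exact: window_top.
  case/allpairsPdep=> a [v [+ + ->]]; rewrite mem_iota => /andP[a0].
  rewrite add1n ltnS => am; rewrite IH => [|]; last by lia.
  by apply: window_cat_block; rewrite a0.
case/window_split=> [[-> ->]|[a [v [am W ->]]]]; first by rewrite mem_head.
apply/orP; right; apply/allpairsPdep; exists a, v; split=> //.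
  by rewrite mem_iota add1n ltnS.
by rewrite IH //; move: am; rewrite leq_min; lia.
Qed.

Lemma last_block n a (x : int) : (0 < a)%N -> last x (block n a) = - (n - a).+1%:Z.
Proof. by case: a => // a _; rewrite /block /= rev_cons map_rcons last_rcons. Qed.

(** The last letter separates the cases: it is positive in a nonempty [top_window] and equals
    -(n-a+1) after appending [block n a]. Equal a then makes the prefixes comparable, as both have
    length n-a. *)
Lemma uniq_windows k f n : (n < f)%N -> uniq (windows k f n).
Proof.
elim: f n => // f IH n nf; rewrite /= cat_uniq; apply/and3P; split.
- by case: ifP.
- apply/hasPn=> _ /allpairsPdep[a [v [+ _ ->]]]; rewrite mem_iota => /andP[a0 am].
  case: ifP => //= _; rewrite inE; apply/negP=> /eqP E.
  have := mem_last 0 (top_window n); rewrite -E last_cat last_block // E inE.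
  by case/orP=> [/eqP//|/mapP[i _]]; lia.
- apply: allpairs_uniq_dep; rewrite ?iota_uniq //.
    by move=> a; rewrite mem_iota => am; apply: IH; lia.
  move=> _ _ /allpairsPdep[a [v [+ + ->]]] /allpairsPdep[b [v' [+ + ->]]] /=.
  rewrite !mem_iota => am + bm.
  rewrite !mem_windows; try lia.
  move=> /size_window sv /size_window sv' E.
  have ab : a = b.
    have := congr1 (last 0) E; rewrite !last_cat !last_block; lia.
  case: b / ab sv' bm E => sv' _ /eqP.
  by rewrite eqseq_cat ?sv ?sv' // => /andP[/eqP -> _].
Qed.

Lemma fk_rec k n : (0 < k)%N ->
  fk k (n + k + 1) = ((n.*2 <= k) + \sum_(1 <= a < (minn k n).+1) fk k (n - a + k + 1))%N.
Proof.
move=> k0; rewrite fkE ?addn1 // ltnS leq_addl.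
rewrite (@big_cat_nat _ _ _ (minn k n).+1) //=; last by rewrite ltnS geq_minl.
rewrite [RHS]addnC; congr (_ + _)%N.
  by apply: eq_big_nat => a /andP[a0]; rewrite ltnS leq_min => /andP[_ an]; congr (fk k _); lia.
(* For n < j <= k the index n+k+1-j is at most k, so the term is an initial value, equal to 1 only
   at j = n+k-k./2. This j is in range exactly when 2n <= k. *)
transitivity (\sum_((minn k n).+1 <= j < k.+1 | j == n + k - k./2) 1)%N.
  rewrite [RHS]big_mkcond; apply: eq_big_nat => j jk.
  rewrite fkE; last by lia.
  have -> : (k < (n + k).+1 - j)%N = false by lia.
  have -> : ((n + k).+1 - j == k./2.+1)%N = (j == n + k - k./2)%N.
    by lia.
  by [].
rewrite big_nat1_eq; set c := (X in if X then _ else _).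
by have -> : c = (n.*2 <= k)%N by rewrite /c; lia.
Qed.

Lemma size_windows k f n : (0 < k)%N -> (n < f)%N ->
  size (windows k f n) = fk k (n + k + 1).
Proof.
move=> k0; elim: f n => // f IH n nf; rewrite fk_rec //= size_cat.
congr (_ + _)%N; first by case: ifP.
rewrite size_allpairs_dep sumnE big_map /index_iota subn1 /=.
rewrite !big_seq; apply: eq_bigr => a; rewrite mem_iota => am.
by rewrite IH //; lia.
Qed.

(** * Signed permutations as windows *)

Lemma in_pmE n (x : int) : in_pm n x = (0 < `|x|%N <= n)%N.
Proof. by rewrite /in_pm; apply/andP/andP; lia. Qed.

Lemma pm_bound n (x : pm n) : (0 < `|val x|%N <= n)%N.
Proof. by rewrite -in_pmE; exact: pm_valP. Qed.

(* Takes the junk value 0 outside [±n], which keeps wval w odd. *)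
Definition wval n (w : {perm pm n}) (x : int) : int :=
  if insub x is Some y then val (w y) else 0.

Definition window_of n (w : {perm pm n}) : seq int := map (wval w) (top_window n).

Lemma wvalE n (w : {perm pm n}) (x : pm n) : wval w (val x) = val (w x).
Proof. by rewrite /wval valK. Qed.

Lemma pm_oppK n : involutive (@pm_opp n).
Proof. by move=> x; apply: val_inj; rewrite /= opprK. Qed.

(** [SB] asks for oddness at positive x only; for negative x it is applied to -x. *)
Lemma SB_opp n (w : {perm pm n}) x : w \in SB n -> w (pm_opp x) = pm_opp (w x).
Proof.
rewrite inE => /forallP H.
have /andP[x0 _] := pm_bound x.
have [/(implyP (H x))/eqP // | xN] := boolP (0 < val x).
have /(implyP (H (pm_opp x)))/eqP : 0 < val (pm_opp x) by move: x0 xN => /=; lia.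
by rewrite pm_oppK => /(congr1 (@pm_opp n)); rewrite pm_oppK.
Qed.

Lemma wval_opp n (w : {perm pm n}) x : w \in SB n -> wval w (- x) = - wval w x.
Proof.
move=> wS; rewrite {2}/wval; case: insubP => [y _ <-|xN].
  by rewrite -[- val y]/(val (pm_opp y)) wvalE SB_opp.
by rewrite /wval insubN // /in_pm normrN.
Qed.

Lemma full_window_of n (w : {perm pm n}) : w \in SB n ->
  full (window_of w) = map (wval w) (full (top_window n)).
Proof.
move=> wS; rewrite /full map_cat map_rev; congr (rev _ ++ _).
by rewrite -map_comp -[RHS]map_comp; apply: eq_map => i /=; rewrite wval_opp.
Qed.

Lemma mem_full_top n (x : int) : (x \in full (top_window n)) = in_pm n x.
Proof.
by rewrite mem_full_abs -map_comp map_id_in // mem_iota add1n ltnS in_pmE.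
Qed.

(** Lets increasing index choices in [±n] be handled as subsequences of -n, ..., n. Such a list is
    determined by its letters, hence is a filter of that word. *)
Lemma subseq_full_top n (t : seq int) :
  subseq t (full (top_window n)) <-> sorted <%R t /\ all (in_pm n) t.
Proof.
have S := sorted_top n; split=> [ts|[St /allP tn]].
  split; first exact: subseq_lt_sorted S.
  by apply/allP=> x /(mem_subseq ts); rewrite mem_full_top.
suff -> : t = filter [in t] (full (top_window n)) by exact: filter_subseq.
apply: lt_sorted_eq => //; first exact: lt_sorted_filter.
move=> x; rewrite mem_filter mem_full_top; apply/idP/andP=> [xt|[]//].
by split=> //; exact: tn.
Qed.

Lemma globally_containsP n m (w : {perm pm n}) (p : 'S_m) :
  reflect (exists t : seq int, [/\ size t = m, subseq t (full (top_window n))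
     & forall a b : 'I_m, (wval w t`_a < wval w t`_b) = (p a < p b)%N])
  (globally_contains w p).
Proof.
apply: (iffP existsP) => [[i /andP[/forallP incr /forallP pat]]|[t [st /subseq_full_top[St tn] pat]]].
  have E (a : 'I_m) : [seq val (i a) | a <- enum 'I_m]`_a = val (i a).
    by rewrite (nth_map a) ?nth_ord_enum // size_enum_ord.
  exists [seq val (i a) | a <- enum 'I_m]; split.
  - by rewrite size_map size_enum_ord.
  - apply/subseq_full_top; split; last by apply/allP=> _ /mapP[a _ ->]; exact: pm_valP.
    have : sorted ltn (map val (enum 'I_m)) by rewrite val_enum_ord iota_ltn_sorted.
    rewrite !sorted_map; apply: sub_sorted => a b /= ab.
    exact: (implyP (forallP (incr a) b)).
  - by move=> a b; rewrite !E !wvalE; apply/eqP/(forallP (pat a)).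
have tP (a : 'I_m) : in_pm n t`_a by rewrite (allP tn) // mem_nth // st.
exists [ffun a => Pm (tP a)]; apply/andP; split; apply/forallP=> a; apply/forallP=> b.
  rewrite !ffunE /=; apply/implyP=> ab.
  by rewrite (lt_sorted_ltn_nth _ St) // inE st.
by rewrite !ffunE -pat -!wvalE.
Qed.

Lemma subseq_mapE (S T : eqType) (f : S -> T) (t : seq T) (s : seq S) :
  subseq t (map f s) -> exists2 r, subseq r s & t = map f r.
Proof.
case/subseqP=> m _ ->; exists (mask m s); first exact: mask_subseq.
by rewrite map_mask.
Qed.

Lemma pat132E (a : 'I_3) : val (pat132 a) = nth 0%N [:: 0; 2; 1]%N a.
Proof.
have := congr1 (fun s => nth 0%N s a) pat132_one_line.
rewrite (nth_map a) ?size_enum_ord // nth_ord_enum.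
by case: a => [[|[|[|]]]] //= lt3 [].
Qed.

Lemma avoids_pat132 n (w : {perm pm n}) : w \in SB n ->
  globally_avoids w pat132 <-> seq_avoids132 (full (window_of w)).
Proof.
move=> wS; rewrite full_window_of //; split=> [/globally_containsP wN x y z|wA].
  case/subseq_mapE=> -[|a [|b [|c []]]] // abc [-> -> ->] lt_ac.
  apply: wN; exists [:: a; b; c]; split=> // i j; rewrite !pat132E.
  by case: i => [[|[|[|]]]] //= _; case: j => [[|[|[|]]]] //= _; lia.
apply/globally_containsP=> -[t []].
case: t => [|a [|b [|c []]]] // _ abc pat.
apply: (wA _ _ _ (map_subseq (wval w) abc)).
have := pat (inord 0) (inord 2); have := pat (inord 2) (inord 1).
by rewrite !pat132E !inordK //= => -> ->.
Qed.

Lemma avoids_pat_incr k n (w : {perm pm n}) : w \in SB n ->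
  globally_avoids w (pat_incr k.+1) <-> incr_le k (full (window_of w)).
Proof.
move=> wS; rewrite full_window_of //; split=> [/globally_containsP wN s|wI].
  move=> /subseq_mapE[t ts ->] St; rewrite leqNgt; apply/negP=> kt.
  (* The increasing subsequence may be longer than k+1; its first k+1 indices give an occurrence. *)
  rewrite size_map in kt; apply: wN; exists (take k.+1 t); split.
  - by rewrite size_takel.
  - exact: subseq_trans (take_subseq _ _) ts.
  move=> a b; rewrite !perm1 !nth_take //.
  have lt_t (i : 'I_k.+1) : (i < size t)%N := leq_trans (ltn_ord i) kt.
  rewrite -!(nth_map 0 0 (wval w)) //.
  by rewrite (lt_sorted_ltn_nth _ St) // inE size_map.
apply/globally_containsP=> -[t [st ts pat]].
have St : sorted <%R (map (wval w) t).
  apply/(sortedP 0) => i; rewrite size_map st => ik.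
  rewrite !(nth_map 0) ?st // ?(ltnW ik) //.
  by have := pat (Ordinal (ltnW ik)) (Ordinal ik); rewrite !perm1 /= => ->.
by have := wI _ (map_subseq (wval w) ts) St; rewrite size_map st ltnn.
Qed.

Lemma perm_window_of n (w : {perm pm n}) : w \in SB n ->
  perm_eq (map absz (window_of w)) (iota 1 n).
Proof.
move=> wS; have iotaP i : i \in iota 1 n -> in_pm n i.
  by rewrite mem_iota add1n ltnS in_pmE.
have U : uniq (map absz (window_of w)).
  rewrite /window_of /top_window -!map_comp map_inj_in_uniq ?iota_uniq //.
  move=> i j /iotaP iP /iotaP jP /=.
  rewrite -[i%:Z]/(val (Pm iP)) -[j%:Z]/(val (Pm jP)) !wvalE => E.
  (* In the second case w(i) = w(-j), hence i = -j, impossible for positive i and j. *)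
  have : val (w (Pm iP)) = val (w (Pm jP)) \/ val (w (Pm iP)) = - val (w (Pm jP)).
    by move: (val (w _)) (val (w _)) E => a b; lia.
  rewrite -[- val _]/(val (pm_opp _)) -SB_opp //; move: iP jP {E} => iP jP.
  case=> /val_inj/perm_inj/(congr1 val) /=; first by case.
  by move: iP jP; rewrite !in_pmE; lia.
have [] := @uniq_min_size _ _ (iota 1 n) U; last by move=> _; apply: uniq_perm; rewrite ?iota_uniq.
  move=> _ /mapP[_ /mapP[_ /mapP[i /iotaP iP ->] ->] ->].
  rewrite -[i%:Z]/(val (Pm iP)) wvalE mem_iota.
  by rewrite add1n ltnS pm_bound.
by rewrite !size_map.
Qed.

Lemma window_of_inj n : {in SB n &, injective (@window_of n)}.
Proof.
move=> w w' wS wS' /eq_in_map E; apply/permP=> x; apply: val_inj.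
rewrite -!wvalE; have : val x \in full (top_window n) by rewrite mem_full_top; exact: pm_valP.
rewrite mem_full => /orP[/E //|/E]; rewrite !wval_opp //; exact: oppr_inj.
Qed.

(** The odd extension of u; the predecessor appears because lists are indexed from 0. *)
Definition of_window (u : seq int) (x : int) : int :=
  if 0 < x then u`_(`|x|%N.-1) else - u`_(`|x|%N.-1).

Lemma absz_of_window u x : `|of_window u x|%N = `|(u`_(`|x|%N.-1))%R|%N.
Proof. by rewrite /of_window; case: ifP; rewrite ?abszN. Qed.

(** As c and -c differ, the value reveals the sign of the argument, whose absolute value is already
    known. *)
Lemma signed_inj (c a b : int) : c != 0 -> `|a|%N = `|b|%N ->
  (if 0 < a then c else - c) = (if 0 < b then c else - c) -> a = b.
Proof. by case: ifP; case: ifP; lia. Qed.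

Lemma window_of_surj k n u : window k n u -> exists2 w, w \in SB n & window_of w = u.
Proof.
move=> W; have [/perm_uniq Uu _ _] := W; rewrite iota_uniq in Uu.
have lt_u (x : pm n) : (`|val x|%N.-1 < size u)%N.
  by rewrite (size_window W); have := pm_bound x; lia.
have pmE (x : pm n) : in_pm n (of_window u (val x)).
  by rewrite in_pmE absz_of_window (mem_window W) // mem_nth.
have inj : injective (fun x => Pm (pmE x)).
  move=> x y E0; apply: val_inj.
  have E : of_window u (val x) = of_window u (val y) := congr1 val E0.
  (* The letters of u have distinct absolute values, so the position is recovered first and the sign
     afterwards. *)
  have absE : `|val x|%N = `|val y|%N.
    have /eqP := congr1 absz E; rewrite !absz_of_window.
    rewrite -!(nth_map 0 0%N absz) // nth_uniq ?size_map //.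
    by have := pm_bound x; have := pm_bound y; lia.
  have c0 : u`_(`|val y|%N.-1) != 0.
    by have /andP[] := mem_window W (mem_nth 0 (lt_u y)); rewrite absz_gt0.
  by move: E; rewrite /of_window absE; exact: signed_inj.
exists (perm inj).
  rewrite inE; apply/forallP=> x; apply/implyP=> x0; apply/eqP; apply: val_inj.
  by rewrite !permE /= /of_window abszN oppr_gt0 x0 ltNge ltW.
apply: (@eq_from_nth _ 0) => [|i]; rewrite !size_map size_iota ?(size_window W) // => i_n.
rewrite /window_of /top_window -map_comp (nth_map 0%N) ?size_iota // nth_iota // add1n /=.
have iP : in_pm n i.+1 by rewrite in_pmE.
by rewrite -[i.+1%:Z]/(val (Pm iP)) wvalE permE.
Qed.

(* The count *)
Local Close Scope ring_scope.

Theorem theorem6p4 (k n : nat) (hk : (1 <= k)%N) (hn : (1 <= n)%N) :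
  #|[set w in SB n | globally_avoids w pat132
                     & globally_avoids w (pat_incr k.+1)]| = fk k (n + k + 1)%N.
Proof.
rewrite -(size_windows hk (ltnSn n)) cardE -(size_map (@window_of n)).
set A := [set w in SB n | _ & _].
have AP w : reflect (w \in SB n /\ window k n (window_of w)) (w \in A).
  rewrite [w \in A]in_set; apply: (iffP and3P) => [[wS /avoids_pat132 a /avoids_pat_incr b]|[wS [_ a b]]].
    by split=> //; split; [exact: perm_window_of | exact: a | exact: b].
  by split=> //; [apply/avoids_pat132 | apply/avoids_pat_incr].
(* [window_of] sends the avoiders bijectively onto the enumerated windows: both lists are
   duplicate-free with the same members. *)
apply/perm_size/uniq_perm.
- rewrite map_inj_in_uniq ?enum_uniq // => w w'; rewrite !mem_enum.
  by move=> /AP[wS _] /AP[wS' _]; exact: window_of_inj.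
- exact: uniq_windows.
move=> u; apply/mapP/idP => [[w + ->]|].
  by rewrite mem_enum mem_windows // => /AP[].
rewrite mem_windows // => /[dup] W /window_of_surj[w wS wu].
by exists w; rewrite ?wu // mem_enum; apply/AP; rewrite wu.
Qed.
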